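(* Let $c,\rho\in\mathbb R$ and consider the Sokolov Hamiltonian on $e^*(3)$ $$\widehat H=J_1^2+J_2^2+2J_3^2-2\rho J_3+2c\,(J_3x_2-J_2x_3).$$ Put $T=cx_2+J_3-\rho$ and $C_2=x_1J_1+x_2J_2+x_3J_3$. On the open set $C_2\neq0$ let $\widetilde P'$ be the bivector whose bracket $\{\cdot,\cdot\}'$ on the coordinates is $$\begin{aligned} \{x_1,x_2\}'&=J_3+C_2^{-1}\,T\,(-cx_2x_3+J_1x_1+J_2x_2-J_3x_3+\rho x_3),\\ \{x_1,x_3\}'&=cx_3-J_2+C_2^{-1}\,T\,x_2\,(cx_2+2J_3-\rho),\\ \{x_2,x_3\}'&=J_1-C_2^{-1}\,T\,x_1\,(cx_2+2J_3-\rho),\\ \{x_1,J_1\}'&=-C_2^{-1}\,T\,J_1(J_2-cx_3),\\ \{x_1,J_2\}'&=-cJ_2+C_2^{-1}\,T\,J_1^2,\\ \{x_1,J_3\}'&=-cJ_3+C_2^{-1}\,c\,T\,(x_2J_2+x_3J_3),\\ \{x_2,J_1\}'&=cJ_2-C_2^{-1}\,T\,J_2(J_2-cx_3),\\ \{x_2,J_2\}'&=C_2^{-1}\,T\,J_1J_2,\\ \{x_2,J_3\}'&=-C_2^{-1}\,c\,T\,x_1J_2,\\ \{x_3,J_1\}'&=-C_2^{-1}\,T\,(cx_1J_1+cx_2J_2+J_2J_3),\\ \{x_3,J_2\}'&=C_2^{-1}\,T\,J_1J_3,\\ \{x_3,J_3\}'&=cJ_1-C_2^{-1}\,c\,T\,x_1J_3,\\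 \{J_1,J_2\}'&=0,\qquad \{J_1,J_3\}'=c^2J_2,\qquad \{J_2,J_3\}'=0 . \end{aligned}$$ Then $\widetilde P'$ defines a (rational) bi-Hamiltonian structure for the Sokolov system: $\widetilde P'$ is a Poisson bivector compatible with the Lie–Poisson bivector $P$ of $e^*(3)$, and the integrals of motion of the Sokolov system are in involution with respect to both brackets, i.e. there is a polynomial $\widehat K$ in $x,J$, functionally independent of $\widehat H,C_1,C_2$, such that $$\{\widehat H,\widehat K\}=0,\qquad \{\widehat H,\widehat K\}'=0 .$$
   Context: Coordinates on $e^*(3)$ are $x=(x_1,x_2,x_3)$, $J=(J_1,J_2,J_3)$; the bivector $P$ is given by $\{J_i,J_j\}=\varepsilon_{ijk}J_k$, $\{J_i,x_j\}=\varepsilon_{ijk}x_k$, $\{x_i,x_j\}=0$, with $\varepsilon_{ijk}$ the totally skew-symmetric tensor (summation over $k$). Its Casimir functions are $C_1=x_1^2+x_2^2+x_3^2$ and $C_2=x_1J_1+x_2J_2+x_3J_3$. A bivector $P$ is Poisson if its Schouten bracket $[\![P,P]\!]$ vanishes (equivalently, its bracket satisfies the Jacobi identity); two Poisson bivectors $P,P'$ are compatible if $[\![P,P']\!]=0$, i.e. $P+\lambda P'$ is Poisson for all $\lambda$. ''Bi-Hamiltonian structure'' for an integrable system with integrals $H_i$ means a second Poisson bivector $P'$ compatible with $P$ such that $\{H_i,H_k\}=\{H_i,H_k\}'=0$ for all $i,k$. *)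

(* Defs.v *)
From HB Require Import structures.
From mathcomp Require Import all_boot all_order all_algebra.
From mathcomp Require Import boolp classical_sets reals topology normedtype.
From mathcomp Require Import derive.
From mathcomp Require mpoly. (* not imported: its notations clash *)

Set Implicit Arguments.
Unset Strict Implicit.
Unset Printing Implicit Defensive.

Import Order.TTheory GRing.Theory Num.Theory.
Import numFieldNormedType.Exports.

Local Open Scope classical_set_scope.
Local Open Scope ring_scope.

Section Bivectors.
Variables (R : realType) (n : nat).
Implicit Types (U : set 'rV[R]_n) (f g : 'rV[R]_n -> R).
Implicit Types (P Q : 'rV[R]_n -> 'M[R]_n).

Definition partial (i : 'I_n) f (p : 'rV[R]_n) : R :=
  'D_(delta_mx 0 i : 'rV[R]_n) f p.

(* C^oo on [U] (an open set in all uses): every iterated partial derivative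
   is differentiable at every point of [U]. *)
Definition smooth_on U f : Prop :=
  forall (s : seq 'I_n) (p : 'rV[R]_n),
    U p -> differentiable (foldr partial f s) p.

(* A bivector is given by its matrix of coefficients P i j = {z_i, z_j} in the
   linear coordinates z. *)
Definition bivector_on U P : Prop :=
  (forall i j, smooth_on U (fun p => P p i j)) /\
  (forall p, U p -> (P p)^T = - P p).

Definition bracket P f g (p : 'rV[R]_n) : R :=
  \sum_(i < n) \sum_(j < n) P p i j * partial i f p * partial j g p.

(* Coefficient (i, j, k) of the Schouten bracket [[P, Q]], up to a sign
   convention; [schouten P P] is twice the Jacobiator
   {{z_i,z_j},z_k} + cyclic, up to sign. *)
Definition schouten P Q (p : 'rV[R]_n) (i j k : 'I_n) : R :=
  let S (a b d : 'I_n) :=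
    \sum_(l < n) (P p l d * partial l (fun q => Q q a b) p +
                  Q p l d * partial l (fun q => P q a b) p) in
  S i j k + S j k i + S k i j.

Definition poisson_on U P : Prop :=
  bivector_on U P /\ (forall p, U p -> forall i j k, schouten P P p i j k = 0).

Definition compatible_on U P Q : Prop :=
  forall p, U p -> forall i j k, schouten P Q p i j k = 0.

(* The differentials are linearly independent at the points of a dense set. *)
Definition functionally_independent (k : nat)
    (F : k.-tuple ('rV[R]_n -> R)) : Prop :=
  dense [set p : 'rV[R]_n |
    row_free (\matrix_(a < k, j < n) partial j (tnth F a) p)].

Definition polyfun (K : mpoly.mpoly n R) (p : 'rV[R]_n) : R :=
  mpoly.meval (p 0) K.

End Bivectors.

Section Sokolov.
Variable R : realType.

(* A point of e^*(3) is the row vector (x_1, x_2, x_3, J_1, J_2, J_3); the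
   index k - 1 : 'I_3 stands for the paper's k. *)
Definition e3 := 'rV[R]_(3 + 3).

Definition xc (p : e3) (k : 'I_3) : R := p 0 (lshift 3 k).
Definition Jc (p : e3) (k : 'I_3) : R := p 0 (rshift 3 k).

Definition eps (i j k : 'I_3) : R :=
  if (i, j, k) \in [:: (0, 1, 2); (1, 2, 0); (2, 0, 1)] then 1
  else if (i, j, k) \in [:: (0, 2, 1); (2, 1, 0); (1, 0, 2)] then -1
  else 0.

Definition C1 (p : e3) : R := \sum_(k < 3) xc p k ^+ 2.
Definition C2 (p : e3) : R := \sum_(k < 3) xc p k * Jc p k.

(* {x_i, J_j} = - {J_j, x_i} = - eps j i k x_k. *)
Definition lie_poisson (p : e3) : 'M[R]_(3 + 3) :=
  block_mx 0
           (\matrix_(i, j) - \sum_(k < 3) eps j i k * xc p k)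
           (\matrix_(i, j) \sum_(k < 3) eps i j k * xc p k)
           (\matrix_(i, j) \sum_(k < 3) eps i j k * Jc p k).

Definition sokolov_H (c rho : R) (p : e3) : R :=
  let x2 := xc p 1 in let x3 := xc p 2 in
  let J1 := Jc p 0 in let J2 := Jc p 1 in let J3 := Jc p 2 in
  J1 ^+ 2 + J2 ^+ 2 + 2 * J3 ^+ 2 - 2 * rho * J3
  + 2 * c * (J3 * x2 - J2 * x3).

(* Entries strictly above the diagonal; positions 0, 1, 2 are x_1, x_2, x_3 and
   3, 4, 5 are J_1, J_2, J_3. *)
Definition sokolov_entry (c rho : R) (p : e3) (i j : nat) : R :=
  let x1 := xc p 0 in let x2 := xc p 1 in let x3 := xc p 2 in
  let J1 := Jc p 0 in let J2 := Jc p 1 in let J3 := Jc p 2 in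
  let T := c * x2 + J3 - rho in
  let D := (C2 p)^-1 in
  match i, j with
  | 0%N, 1%N =>
      J3 + D * T * (- c * x2 * x3 + J1 * x1 + J2 * x2 - J3 * x3 + rho * x3)
  | 0%N, 2%N => c * x3 - J2 + D * T * x2 * (c * x2 + 2 * J3 - rho)
  | 1%N, 2%N => J1 - D * T * x1 * (c * x2 + 2 * J3 - rho)
  | 0%N, 3%N => - (D * T * J1 * (J2 - c * x3))
  | 0%N, 4%N => - c * J2 + D * T * J1 ^+ 2
  | 0%N, 5%N => - c * J3 + D * c * T * (x2 * J2 + x3 * J3)
  | 1%N, 3%N => c * J2 - D * T * J2 * (J2 - c * x3)
  | 1%N, 4%N => D * T * J1 * J2
  | 1%N, 5%N => - (D * c * T * x1 * J2)
  | 2%N, 3%N => - (D * T * (c * x1 * J1 + c * x2 * J2 + J2 * J3))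
  | 2%N, 4%N => D * T * J1 * J3
  | 2%N, 5%N => c * J1 - D * c * T * x1 * J3
  | 3%N, 4%N => 0
  | 3%N, 5%N => c ^+ 2 * J2
  | 4%N, 5%N => 0
  | _, _ => 0
  end.

Definition sokolov_P' (c rho : R) (p : e3) : 'M[R]_(3 + 3) :=
  \matrix_(i, j) if (i < j)%N then sokolov_entry c rho p i j
                 else if (j < i)%N then - sokolov_entry c rho p j i
                 else 0.

End Sokolov.

(* Main.v *)
From HB Require Import structures.
Require Import Defs.
From mathcomp Require Import all_boot all_order all_algebra.
From mathcomp Require Import boolp classical_sets functions reals topology normedtype.
From mathcomp Require Import landau derive.
From mathcomp Require mpoly.
From mathcomp Require Import ring lra.

Set Implicit Arguments.
Unset Strict Implicit.
Unset Printing Implicit Defensive.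

Import Order.TTheory GRing.Theory Num.Theory.
Import numFieldNormedType.Exports.
Import (canonicals) mpoly. (* its notations clash with those of analysis *)
Local Open Scope classical_set_scope.
Local Open Scope ring_scope.

(** All functions involved are values of rational expressions, whose partial
    derivatives are computed symbolically, so the Jacobi and compatibility
    conditions become identities between rational functions.

    The Hamiltonian is a Casimir function of the second bracket: P' dH = 0.
    Hence any K commuting with H for the Lie-Poisson bracket will do, and one
    is K = T (T |J|^2 - 2 c J_2 C_2), with T = c x_2 + J_3 - rho.  At
    x = (1, 0, 0), J = (0, 2, 1 + rho) the differentials of H, K, C_1, C_2 are
    independent for all c and rho; a nonvanishing minor is a polynomial, so it
    has only finitely many zeros on the line joining any point to this one,
    which gives independence on a dense set. *)

(** The first-order expansion of [f] at [x] only sees its germ, so it is also an expansion of [g].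
    Uniqueness of the differential then identifies its linear part with ['d g x]. *)
Lemma near_eq_differentiable (R : numFieldType) (V W : normedModType R)
    (f g : V -> W) (x : V) :
  (\forall y \near x, f y = g y) -> differentiable f x -> differentiable g x.
Proof.
move=> fg /diff_locallyP [dc df].
have dg : g \o shift x = cst (g x) + 'd f x +o_ 0 id.
  apply/eqaddoP => e e0; move/eqaddoP/(_ _ e0): df.
  have := fg; rewrite (near_shift 0 x) => fg0.
  apply: filterS2 fg0 => y /= fgy.
  by rewrite !fctE /= -(nbhs_singleton fg) subr0 in fgy *; rewrite fgy.
have E := diff_unique dc dg.
apply/diff_locallyP; split; first by rewrite E.
by rewrite {1}dg E.
Qed.

(** * Symbolic differentiation of rational expressions *)

Section RationalExpressions.
Variables (R : realType) (n : nat).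
Local Notation pt := 'rV[R]_n.+1.

(** Variables carry a bare [nat] rather than an ordinal, so that [pd] at concrete indices reduces by
    computation. *)
Inductive ratexp : Type :=
  | RCst of R
  | RVar of nat
  | ROpp of ratexp
  | RAdd of ratexp & ratexp
  | RMul of ratexp & ratexp
  | RInv of ratexp.

Fixpoint ev (e : ratexp) (p : pt) : R :=
  match e with
  | RCst a => a
  | RVar k => p 0 (inord k)
  | ROpp e1 => - ev e1 p
  | RAdd e1 e2 => ev e1 p + ev e2 p
  | RMul e1 e2 => ev e1 p * ev e2 p
  | RInv e1 => (ev e1 p)^-1
  end.

Fixpoint defined (e : ratexp) (p : pt) : Prop :=
  match e with
  | RCst _ | RVar _ => True
  | ROpp e1 => defined e1 p
  | RAdd e1 e2 | RMul e1 e2 => defined e1 p /\ defined e2 p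
  | RInv e1 => defined e1 p /\ ev e1 p != 0
  end.

Fixpoint pd (i : nat) (e : ratexp) : ratexp :=
  match e with
  | RCst _ => RCst 0
  | RVar k => RCst (if Nat.eqb k i then 1 else 0)
  | ROpp e1 => ROpp (pd i e1)
  | RAdd e1 e2 => RAdd (pd i e1) (pd i e2)
  | RMul e1 e2 => RAdd (RMul (pd i e1) e2) (RMul e1 (pd i e2))
  | RInv e1 => ROpp (RMul (RMul (RInv e1) (RInv e1)) (pd i e1))
  end.

(* [inord k] is junk for [k > n], where [pd] would disagree with [partial]. *)
Fixpoint vars_ok (e : ratexp) : bool :=
  match e with
  | RCst _ => true
  | RVar k => (k < n.+1)%N
  | ROpp e1 | RInv e1 => vars_ok e1
  | RAdd e1 e2 | RMul e1 e2 => vars_ok e1 && vars_ok e2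
  end.

Lemma vars_ok_pd i e : vars_ok e -> vars_ok (pd i e).
Proof.
elim: e => //= [e1 h1 e2 h2|e1 h1 e2 h2|e1 h1].
- by case/andP => /h1 -> /h2 ->.
- by case/andP => /[dup] /h1 -> -> /[dup] /h2 -> ->.
- by move=> /[dup] /h1 -> ->.
Qed.

Lemma defined_pd i e p : defined e p -> defined (pd i e) p.
Proof. by elim: e => //=; intuition. Qed.

Lemma differentiable_ev e p : defined e p -> differentiable (ev e) p.
Proof.
elim: e => [a|k|e1 h1|e1 h1 e2 h2|e1 h1 e2 h2|e1 h1] /=.
- by move=> _; exact: differentiable_cst.
- by move=> _; exact: differentiable_coord.
- by move=> /h1 d1; exact: differentiableN.
- by move=> [/h1 d1 /h2 d2]; exact: differentiableD.
- by move=> [/h1 d1 /h2 d2]; exact: differentiableM.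
- by move=> [/h1 d1 nz]; exact: differentiableV.
Qed.

Lemma partial_ev (i : 'I_n.+1) e p :
  vars_ok e -> defined e p -> partial i (ev e) p = ev (pd i e) p.
Proof.
rewrite /partial.
have dd e1 : defined e1 p -> derivable (ev e1) p (delta_mx 0 i : pt).
  by move=> d1; exact/diff_derivable/differentiable_ev.
elim: e => [a|k|e1 h1|e1 h1 e2 h2|e1 h1 e2 h2|e1 h1] /=.
- by move=> _ _; exact: derive_cst.
- move=> kn _; rewrite deriveE; last exact: differentiable_coord.
  (* Packed as a linear map, the continuous coordinate function is its own differential. *)
  have L : linear (fun q : pt => q 0 (inord k)) by move=> a u v; rewrite !mxE.
  pose f := GRing.isLinear.Build _ _ _ _ _ L.
  pose g : {linear pt -> R} := HB.pack (fun q : pt => q 0 (inord k)) f.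
  rewrite (_ : (fun _ => _) = g) // diff_lin; last exact: coord_continuous.
  rewrite /= mxE eqxx /=.
  have -> : (inord k == i) = Nat.eqb k i.
    apply/eqP/idP => [<-|/PeanoNat.Nat.eqb_eq ->]; last by rewrite inord_val.
    by rewrite inordK // PeanoNat.Nat.eqb_refl.
  by case: ifP.
- by move=> v1 d1; rewrite deriveN ?h1 //; exact: dd.
- by case/andP=> v1 v2 [d1 d2]; rewrite deriveD ?h1 ?h2 //; exact: dd.
- case/andP=> v1 v2 [d1 d2]; rewrite deriveM ?h1 ?h2 //; try exact: dd.
  by rewrite addrC mulrC [X in _ + X]mulrC /GRing.scale /= mulrC; ring.
- move=> v1 [d1 nz]; rewrite deriveV ?h1 //; last exact: dd.
  by rewrite /GRing.scale /= expr2 invfM mulNr.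
Qed.

(** By induction, each iterated partial agrees on [U] with an expression defined there. As [U] is
    open, this agreement holds near each point and therefore survives differentiation. *)
Lemma smooth_on_ev (U : set pt) e : open U -> vars_ok e ->
  (forall p, U p -> defined e p) -> smooth_on U (ev e).
Proof.
move=> oU ve de s p Up.
suff [e' ve' [de' E]] : exists2 e', vars_ok e' &
    (forall q, U q -> defined e' q) /\
    (forall q, U q -> foldr (@partial R n.+1) (ev e) s q = ev e' q).
  have nE : \forall q \near p, ev e' q = foldr (@partial R n.+1) (ev e) s q.
    by apply: filterS (open_nbhs_nbhs (conj oU Up)) => q Uq; rewrite E.
  by apply: near_eq_differentiable nE _; exact/differentiable_ev/de'.
elim: s => [|i s [e' ve' [de' E]]] /=; first by exists e.
exists (pd i e'); first exact: vars_ok_pd.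
split=> q Uq; first exact/defined_pd/de'.
rewrite -partial_ev //; last exact: de'.
rewrite /partial; apply: near_eq_derive.
by apply: filterS (open_nbhs_nbhs (conj oU Uq)) => r Ur; rewrite E.
Qed.

End RationalExpressions.

(** * Polynomial expressions and independence on a dense set *)

Section PolynomialExpressions.
Variables (R : realType) (n : nat).
Local Notation pt := 'rV[R]_n.+1.
Implicit Types (e : ratexp R) (p q v : pt).

Fixpoint is_poly e : bool :=
  match e with
  | RCst _ | RVar _ => true
  | ROpp e1 => is_poly e1
  | RAdd e1 e2 | RMul e1 e2 => is_poly e1 && is_poly e2
  | RInv _ => false
  end.

Lemma is_poly_defined e p : is_poly e -> defined e p.
Proof. by elim: e => //= [e1 h1 e2 h2|e1 h1 e2 h2] /andP[/h1 ? /h2 ?]. Qed.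

Lemma is_poly_pd i e : is_poly e -> is_poly (pd i e).
Proof.
elim: e => //= [e1 h1 e2 h2|e1 h1 e2 h2] /andP[].
  by move=> /h1 -> /h2 ->.
by move=> /[dup] /h1 -> -> /[dup] /h2 -> ->.
Qed.

(** The value 0 at [RInv] is a placeholder, here and in [on_line]: the evaluation lemmas assume
    [is_poly]. *)
Fixpoint mpoly_of e : mpoly.mpoly n.+1 R :=
  match e with
  | RCst a => mpoly.mpolyC n.+1 a
  | RVar k => mpoly.mpolyX R (mpoly.mnm1 (inord k))
  | ROpp e1 => - mpoly_of e1
  | RAdd e1 e2 => mpoly_of e1 + mpoly_of e2
  | RMul e1 e2 => mpoly_of e1 * mpoly_of e2
  | RInv _ => 0
  end.

Lemma polyfun_mpoly_of e : is_poly e -> polyfun (mpoly_of e) = ev e.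
Proof.
move=> pe; apply/funext => p; rewrite /polyfun.
elim: e pe => //= [a|k|e1 h1|e1 h1 e2 h2|e1 h1 e2 h2].
- by rewrite mpoly.mevalC.
- by rewrite mpoly.mevalXU.
- by move=> /h1 <-; rewrite mpoly.mevalN.
- by move=> /andP[/h1 <- /h2 <-]; rewrite mpoly.mevalD.
- by move=> /andP[/h1 <- /h2 <-]; rewrite mpoly.mevalM.
Qed.

Fixpoint on_line p v e : {poly R} :=
  match e with
  | RCst a => a%:P
  | RVar k => (p 0 (inord k))%:P + v 0 (inord k) *: 'X
  | ROpp e1 => - on_line p v e1
  | RAdd e1 e2 => on_line p v e1 + on_line p v e2
  | RMul e1 e2 => on_line p v e1 * on_line p v e2
  | RInv _ => 0
  end.

Lemma horner_on_line p v e t :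
  is_poly e -> (on_line p v e).[t] = ev e (p + t *: v).
Proof.
elim: e => //= [a|k|e1 h1|e1 h1 e2 h2|e1 h1 e2 h2].
- by rewrite hornerC.
- by rewrite !hornerE !mxE mulrC.
- by move=> /h1 <-; rewrite hornerN.
- by move=> /andP[/h1 <- /h2 <-]; rewrite hornerD.
- by move=> /andP[/h1 <- /h2 <-]; rewrite hornerM.
Qed.

Lemma exists_nonroot_near0 (r : {poly R}) (e : R) :
  r != 0 -> 0 < e -> exists2 t, `|t| < e & r.[t] != 0.
Proof.
move=> r0 e0.
(* These are [size r] distinct points, one more than the degree of [r] allows as roots. Starting the
   denominators at 2 keeps them strictly below [e]. *)
pose s := [seq e / k.+2%:R | k <- iota 0 (size r)].
have us : uniq s.
  rewrite map_inj_uniq ?iota_uniq // => a b /(mulfI (lt0r_neq0 e0)) /invr_inj /eqP.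
  by rewrite eqr_nat !eqSS => /eqP.
have /allPn[t /mapP[k _ ->] nr] : ~~ all (root r) s.
  by apply/negP => /max_poly_roots -/(_ r0 us); rewrite size_map size_iota ltnn.
exists (e / k.+2%:R) => //.
rewrite ger0_norm ?divr_ge0 ?ltW // ltr_pdivrMr // ltr_pMr //.
by rewrite ltr1n.
Qed.

(** The map [f] selects the columns of a maximal minor of the Jacobian matrix. Its restriction to
    the line through [p] and [q] is a nonzero polynomial, hence nonzero at points of the line
    arbitrarily close to [p]. *)
Lemma functionally_independent_ev k (F : k.-tuple (pt -> R))
    (es : 'I_k -> ratexp R) (f : 'I_k -> 'I_n.+1) q :
  (forall a, tnth F a = ev (es a)) ->
  (forall a, is_poly (es a)) -> (forall a, vars_ok n (es a)) ->
  \det (\matrix_(a, b) ev (pd (f b) (es a)) q) != 0 ->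
  functionally_independent F.
Proof.
move=> FE pe ve detq O [p Op] oO.
pose v := q - p.
pose N : 'M[{poly R}]_k := \matrix_(a, b) on_line p v (pd (f b) (es a)).
have detN t : (\det N).[t] =
    \det (\matrix_(a, b) ev (pd (f b) (es a)) (p + t *: v)).
  rewrite -[LHS]/(horner_eval t _) -det_map_mx; congr (\det _).
  by apply/matrixP => a b; rewrite !mxE /= /horner_eval horner_on_line ?is_poly_pd.
have N0 : \det N != 0.
  apply: contraNneq detq => N0; have := detN 1.
  (* At parameter 1 the line reaches [q], where the minor is nonzero. *)
  by rewrite N0 horner0 scale1r addrCA subrr addr0 => <-.
have /nbhs_ballP[e e0 eO] : \forall t \near (0 : R), O (p + t *: v).
  have c : {for 0, continuous (fun t : R => p + t *: v)}.
    apply: continuousD; first exact: cst_continuous.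
    exact: scalel_continuous.
  by apply: c; apply: open_nbhs_nbhs; split; rewrite // scale0r addr0.
have [t te rt] := exists_nonroot_near0 N0 e0.
exists (p + t *: v); split.
  by apply: eO; rewrite -ball_normE /= sub0r normrN.
rewrite /=; apply: inj_row_free => u u0.
have un : (\matrix_(a, b) ev (pd (f b) (es a)) (p + t *: v)) \in unitmx.
  by rewrite unitmxE -detN unitfE.
apply: (can_inj (mulmxK un)); rewrite mul0mx; apply/rowP => b.
(* Column [f b] of the full Jacobian is column [b] of the invertible minor. *)
have := congr1 (fun w : 'rV_n.+1 => w 0 (f b)) u0; rewrite !mxE => {2}<-.
apply: eq_bigr => a _; rewrite !mxE FE partial_ev //.
exact: is_poly_defined.
Qed.

End PolynomialExpressions.

(** * Schouten brackets of bivectors given by antisymmetric tables *)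

Section AntisymmetricTables.
Context {R : realType} {n : nat}.
Implicit Types E F : nat -> nat -> ratexp R.
Local Notation pt := 'rV[R]_n.+1.

Definition antisym E (i j : nat) : ratexp R :=
  if (i < j)%N then E i j else if (j < i)%N then ROpp (E j i) else RCst 0.

Definition schouten_sum E F (p : pt) (a b d : nat) : R :=
  \sum_(l < n.+1) (ev (antisym E l d) p * ev (pd l (antisym F a b)) p +
                   ev (antisym F l d) p * ev (pd l (antisym E a b)) p).

Definition schouten_ev E F p a b d : R :=
  schouten_sum E F p a b d + schouten_sum E F p b d a
  + schouten_sum E F p d a b.

Lemma pd_antisymN l E (p : pt) a b :
  ev (pd l (antisym E b a)) p = - ev (pd l (antisym E a b)) p.
Proof. by rewrite /antisym; case: ltngtP => //=; rewrite ?opprK ?oppr0. Qed.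

Lemma schouten_ev_cycle E F p a b d :
  schouten_ev E F p a b d = schouten_ev E F p b d a.
Proof. by rewrite /schouten_ev [RHS]addrC addrA. Qed.

Lemma schouten_ev_swap E F p a b d :
  schouten_ev E F p b a d = - schouten_ev E F p a b d.
Proof.
have N x y z : schouten_sum E F p y x z = - schouten_sum E F p x y z.
  rewrite -sumrN; apply: eq_bigr => l _.
  by rewrite ![ev (pd l (antisym _ y x)) p]pd_antisymN !mulrN opprD.
by rewrite /schouten_ev (N a b d) (N d a b) (N b d a) !opprD addrAC.
Qed.

(** The bracket is totally antisymmetric: it vanishes on a repeated index, and cyclic shifts and
    swaps sort the others. For [m = 6] this leaves 20 triples out of 216. *)
Lemma schouten_ev_eq0 E F p m :
  (forall a b d, (a < b)%N -> (b < d)%N -> (d < m)%N ->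
     schouten_ev E F p a b d = 0) ->
  forall a b d, (a < m)%N -> (b < m)%N -> (d < m)%N ->
     schouten_ev E F p a b d = 0.
Proof.
move=> H.
have D x z : schouten_ev E F p x x z = 0.
  have /eqP := schouten_ev_swap E F p x x z.
  by rewrite -addr_eq0 -mulr2n mulrn_eq0 /= => /eqP.
have H2 x y z : (x < y)%N -> (z < m)%N -> (y < m)%N ->
    schouten_ev E F p x y z = 0.
  move=> xy zm ym; case: (ltngtP y z) => [yz|zy|<-]; first exact: H.
  - case: (ltngtP x z) => [xz|zx|<-].
    + by rewrite schouten_ev_cycle schouten_ev_swap -schouten_ev_cycle H ?oppr0.
    + by rewrite -schouten_ev_cycle H.
    + by rewrite -schouten_ev_cycle D.
  - by rewrite schouten_ev_cycle D.
move=> a b d am bm dm.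
case: (ltngtP a b) => [ab|ba|->]; [exact: H2| |exact: D].
by rewrite schouten_ev_swap H2 ?oppr0.
Qed.

Lemma schouten_antisym E F (P Q : pt -> 'M[R]_n.+1) p (i j k : 'I_n.+1) :
  (forall q a b, P q a b = ev (antisym E a b) q) ->
  (forall q a b, Q q a b = ev (antisym F a b) q) ->
  (forall a b : 'I_n.+1, vars_ok n (antisym E a b)) ->
  (forall a b : 'I_n.+1, vars_ok n (antisym F a b)) ->
  (forall a b : 'I_n.+1, defined (antisym E a b) p) ->
  (forall a b : 'I_n.+1, defined (antisym F a b) p) ->
  schouten P Q p i j k = schouten_ev E F p i j k.
Proof.
move=> hP hQ vE vF dE dF.
have PE a b : (fun q => P q a b) = ev (antisym E a b) by exact/funext.
have QF a b : (fun q => Q q a b) = ev (antisym F a b) by exact/funext.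
by rewrite /schouten /schouten_ev; congr (_ + _ + _); apply: eq_bigr => l _;
  rewrite !hP !hQ !PE !QF !partial_ev.
Qed.

Lemma antisym_bivector (U : set pt) (P : pt -> 'M[R]_n.+1) E : open U ->
  (forall p a b, P p a b = ev (antisym E a b) p) ->
  (forall a b, vars_ok n (antisym E a b)) ->
  (forall a b p, U p -> defined (antisym E a b) p) ->
  bivector_on U P.
Proof.
move=> oU PE vE dE; split=> [i j | p _].
  have -> : (fun p => P p i j) = ev (antisym E i j) by exact/funext.
  by apply: smooth_on_ev => //; exact: dE.
apply/matrixP => i j; rewrite !mxE !PE /antisym.
by case: ltngtP => //=; rewrite ?opprK ?oppr0.
Qed.

End AntisymmetricTables.

(* The Sokolov data as symbolic expressions *)
Declare Scope rx_scope.
Delimit Scope rx_scope with rx.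

Section Sokolov.
Variable R : realType.
Variables (c rho : R).
Implicit Types p : e3 R.
Local Notation V := (@RVar R).
Local Notation "a + b" := (RAdd a b) : rx_scope.
Local Notation "- a" := (ROpp a) : rx_scope.
Local Notation "a - b" := (RAdd a (ROpp b)) : rx_scope.
Local Notation "a * b" := (RMul a b) : rx_scope.

(** [V 0], [V 1], [V 2] are the coordinates x and [V 3], [V 4], [V 5] the coordinates J. Only
    entries above the diagonal are listed, since [antisym] supplies the rest. *)
Definition lie_poisson_table (i j : nat) : ratexp R :=
  (match i, j with
  | 0%N, 4%N => V 2 | 0%N, 5%N => - V 1
  | 1%N, 3%N => - V 2 | 1%N, 5%N => V 0
  | 2%N, 3%N => V 1 | 2%N, 4%N => - V 0
  | 3%N, 4%N => V 5 | 3%N, 5%N => - V 4 | 4%N, 5%N => V 3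
  | _, _ => RCst 0
  end)%rx.

Definition C2_exp : ratexp R := (V 0 * V 3 + V 1 * V 4 + V 2 * V 5)%rx.

Definition sokolov_table (i j : nat) : ratexp R :=
  (let x1 := V 0 in let x2 := V 1 in let x3 := V 2 in
  let J1 := V 3 in let J2 := V 4 in let J3 := V 5 in
  let c := RCst c in let rho := RCst rho in
  let T := c * x2 + J3 - rho in
  let D := RInv C2_exp in
  match i, j with
  | 0%N, 1%N =>
      J3 + D * T * (- c * x2 * x3 + J1 * x1 + J2 * x2 - J3 * x3 + rho * x3)
  | 0%N, 2%N => c * x3 - J2 + D * T * x2 * (c * x2 + RCst 2 * J3 - rho)
  | 1%N, 2%N => J1 - D * T * x1 * (c * x2 + RCst 2 * J3 - rho)
  | 0%N, 3%N => - (D * T * J1 * (J2 - c * x3))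
  | 0%N, 4%N => - c * J2 + D * T * (J1 * J1)
  | 0%N, 5%N => - c * J3 + D * c * T * (x2 * J2 + x3 * J3)
  | 1%N, 3%N => c * J2 - D * T * J2 * (J2 - c * x3)
  | 1%N, 4%N => D * T * J1 * J2
  | 1%N, 5%N => - (D * c * T * x1 * J2)
  | 2%N, 3%N => - (D * T * (c * x1 * J1 + c * x2 * J2 + J2 * J3))
  | 2%N, 4%N => D * T * J1 * J3
  | 2%N, 5%N => c * J1 - D * c * T * x1 * J3
  | 3%N, 5%N => c * c * J2
  | _, _ => RCst 0
  end)%rx.

Definition C1_exp : ratexp R := (V 0 * V 0 + V 1 * V 1 + V 2 * V 2)%rx.

Definition H_exp : ratexp R :=
  (V 3 * V 3 + V 4 * V 4 + RCst 2 * (V 5 * V 5) - RCst 2 * RCst rho * V 5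
   + RCst 2 * RCst c * (V 5 * V 1 - V 4 * V 2))%rx.

Definition K_exp : ratexp R :=
  (let T := RCst c * V 1 + V 5 - RCst rho in
   T * (T * (V 3 * V 3 + V 4 * V 4 + V 5 * V 5)
        - RCst 2 * RCst c * V 4 * C2_exp))%rx.

Lemma xc0 p : xc p 0 = p 0 (inord 0).
Proof. by congr (p 0 _); apply/val_inj; rewrite /= inordK. Qed.
Lemma xc1 p : xc p 1 = p 0 (inord 1).
Proof. by congr (p 0 _); apply/val_inj; rewrite /= inordK. Qed.
Lemma xc2 p : xc p 2 = p 0 (inord 2).
Proof. by congr (p 0 _); apply/val_inj; rewrite /= inordK. Qed.
Lemma Jc0 p : Jc p 0 = p 0 (inord 3).
Proof. by congr (p 0 _); apply/val_inj; rewrite /= inordK. Qed.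
Lemma Jc1 p : Jc p 1 = p 0 (inord 4).
Proof. by congr (p 0 _); apply/val_inj; rewrite /= inordK. Qed.
Lemma Jc2 p : Jc p 2 = p 0 (inord 5).
Proof. by congr (p 0 _); apply/val_inj; rewrite /= inordK. Qed.
Definition coordE := (xc0, xc1, xc2, Jc0, Jc1, Jc2).

Lemma sum3 (F : 'I_3 -> R) : \sum_(k < 3) F k = F 0 + F 1 + F 2.
Proof.
rewrite !big_ord_recl big_ord0 addr0 addrA.
by congr (_ + F _ + F _); apply/val_inj.
Qed.

Lemma C1E : @C1 R = ev C1_exp.
Proof. by apply/funext => p; rewrite /C1 sum3 !coordE /= !expr2. Qed.

Lemma C2E : @C2 R = ev C2_exp.
Proof. by apply/funext => p; rewrite /C2 sum3 !coordE /=. Qed.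

Lemma HE : sokolov_H c rho = ev H_exp.
Proof. by apply/funext => p; rewrite /sokolov_H !coordE /= !expr2. Qed.

Lemma ord3P (P : 'I_3 -> Prop) : P 0 -> P 1 -> P 2 -> forall i, P i.
Proof.
by move=> P0 P1 P2 [[|[|[|//]]] h];
  [move: P0|move: P1|move: P2]; congr P; apply/val_inj.
Qed.

Lemma lie_poissonE p (i j : 'I_6) :
  lie_poisson p i j = ev (antisym lie_poisson_table i j) p.
Proof.
rewrite /lie_poisson.
case: (split_ordP (i : 'I_(3 + 3))) => i' ->;
  case: (split_ordP (j : 'I_(3 + 3))) => j' ->;
  rewrite ?block_mxEul ?block_mxEur ?block_mxEdl ?block_mxEdr !mxE ?sum3 ?coordE;
  move: i' j'; apply: ord3P; apply: ord3P; rewrite /eps /=; ring.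
Qed.

Lemma sokolov_P'E p (i j : 'I_6) :
  sokolov_P' c rho p i j = ev (antisym sokolov_table i j) p.
Proof.
have T (a b : nat) : (a < b < 6)%N ->
    sokolov_entry c rho p a b = ev (sokolov_table a b) p.
  move: a b => [|[|[|[|[|[|a]]]]]] [|[|[|[|[|[|b]]]]]] //= _;
  by rewrite ?C2E ?coordE /= ?expr2.
by rewrite /sokolov_P' !mxE /antisym; case: ltngtP => // ij /=; rewrite T ?ltn_ord ?ij.
Qed.

Lemma lie_poisson_table_ok a b : vars_ok 5 (antisym lie_poisson_table a b) /\
  forall p, defined (n := 5) (antisym lie_poisson_table a b) p.
Proof.
rewrite /antisym; case: ifP => _; last case: ifP => _ //;
  by case: a b => [|[|[|[|[|[|a]]]]]] [|[|[|[|[|[|b]]]]]].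
Qed.

Lemma sokolov_table_ok a b : vars_ok 5 (antisym sokolov_table a b) /\
  forall p, C2 p != 0 -> defined (n := 5) (antisym sokolov_table a b) p.
Proof.
rewrite C2E /antisym; case: ifP => _; last case: ifP => _ //;
  by case: a b => [|[|[|[|[|[|a]]]]]] [|[|[|[|[|[|b]]]]]]; split=> //= p h;
  intuition.
Qed.

Lemma open_C2 : open [set p : e3 R | C2 p != 0].
Proof.
rewrite C2E; apply: (@open_comp _ _ (ev (n := 5) C2_exp) [set x | x != 0]).
  by move=> p _; apply: differentiable_continuous; exact: differentiable_ev.
exact: open_neq.
Qed.

(** * Jacobi identities, compatibility and involution *)

Ltac gen_coords p :=
  move: (p 0 (inord 0)) (p 0 (inord 1)) (p 0 (inord 2))
    (p 0 (inord 3)) (p 0 (inord 4)) (p 0 (inord 5)).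

(** Leaves one explicit identity in the six coordinates for each strictly increasing triple of
    indices. *)
Ltac schouten_cases :=
  apply: (@schouten_ev_eq0 R 5 _ _ _ 6) => //;
  do 3 (case=> [|[|[|[|[|[|?]]]]]] //);
  move=> _ _ _; rewrite /schouten_ev /schouten_sum !big_ord_recl !big_ord0 /=.

Lemma lie_poisson_jacobi (p : 'rV[R]_6) (i j k : 'I_6) :
  schouten_ev lie_poisson_table lie_poisson_table p i j k = 0.
Proof. schouten_cases; gen_coords p => *; ring. Qed.

Lemma sokolov_jacobi (p : 'rV[R]_6) (i j k : 'I_6) : C2 p != 0 ->
  schouten_ev sokolov_table sokolov_table p i j k = 0.
Proof.
rewrite C2E /= => C20; schouten_cases; move: C20.
all: by gen_coords p => x1 x2 x3 J1 J2 J3 C20; field.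
Qed.

Lemma lie_poisson_sokolov_compatible (p : 'rV[R]_6) (i j k : 'I_6) : C2 p != 0 ->
  schouten_ev lie_poisson_table sokolov_table p i j k = 0.
Proof.
rewrite C2E /= => C20; schouten_cases; move: C20.
all: by gen_coords p => x1 x2 x3 J1 J2 J3 C20; field.
Qed.

Lemma lie_poisson_involution p : bracket (@lie_poisson R) (sokolov_H c rho) (ev K_exp) p = 0.
Proof.
rewrite /bracket HE.
under eq_bigr => i _.
  under eq_bigr => j _ do rewrite lie_poissonE !(@partial_ev _ 5) //.
  over.
by rewrite !(big_ord_recl, big_ord0) /=; gen_coords p => *; ring.
Qed.

(** After the derivatives are computed, each component of P' dH cancels as a rational function with
    denominator [C2]. *)
Lemma sokolov_casimir p (j : 'I_6) : C2 p != 0 ->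
  \sum_(i < 6) sokolov_P' c rho p i j * partial i (sokolov_H c rho) p = 0.
Proof.
rewrite HE => C20.
under eq_bigr => i _ do rewrite sokolov_P'E !(@partial_ev _ 5) //.
rewrite !(big_ord_recl, big_ord0) /=.
move: C20; rewrite C2E /=.
by case: j => [[|[|[|[|[|[|?]]]]]] //] _ /=; gen_coords p => *; field.
Qed.

Lemma sokolov_independent :
  functionally_independent
    [tuple sokolov_H c rho; ev K_exp; @C1 R; @C2 R].
Proof.
rewrite HE C1E C2E.
pose es (a : 'I_4) := nth (RCst 0) [:: H_exp; K_exp; C1_exp; C2_exp] a.
(* At [q] only the columns of x_1 and J_1 meet the rows of C_1 and C_2. *)
pose f (b : 'I_4) : 'I_6 := nth ord0 [:: inord 4; inord 5; inord 0; inord 3] b.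
(* This choice gives T = 1 and C_2 = 0 at [q], and the J_2 and J_3 derivatives of H and K become
   free of [c]. *)
pose q : 'rV[R]_6 := \row_j nth 0 [:: 1; 0; 0; 0; 2; 1 + rho] j.
apply: (@functionally_independent_ev R 5 4 _ es f q).
- by case=> [[|[|[|[|?]]]] //] h; rewrite (tnth_nth (ev (RCst 0))) /=.
- by case=> [[|[|[|[|?]]]] //] h.
- by case=> [[|[|[|[|?]]]] //] h.
rewrite -unitfE -unitmxE -row_free_unit; apply: inj_row_free => v v0.
have eqn b := congr1 (fun w : 'rV_4 => w 0 b) v0.
have qE k : (k < 6)%N -> q 0 (inord k) = nth 0 [:: 1; 0; 0; 0; 2; 1 + rho] k.
  by move=> k6; rewrite mxE inordK.
have := (eqn 0, eqn 1, eqn 2, eqn 3).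
rewrite !mxE !big_ord_recl !big_ord0 !mxE /f /es /= !inordK //= !qE //=.
set x := v 0 _; set y := v 0 _; set z := v 0 _; set w := v 0 _.
move=> [[[eJ2 eJ3] ex1] eJ1].
have yE : y = - x by lra.
have x0 : x = 0.
  (* Substituting the J_2 equation y = -x into the J_3 equation leaves this factor, which is at
     least 6 for every real [rho]. *)
  have /eqP : x * (6 + 2 * (1 + rho) ^+ 2) = 0.
    by rewrite -[RHS]oppr0 -eJ3 yE; ring.
  rewrite mulf_eq0 => /orP[/eqP //|]; rewrite gt_eqF //.
  by rewrite ltr_pwDl // mulr_ge0 // sqr_ge0.
rewrite yE x0 in ex1 eJ1.
have z0 : z = 0 by lra.
have w0 : w = 0 by rewrite z0 in eJ1; lra.
apply/rowP => k; rewrite mxE.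
case: k => [[|[|[|[|?]]]] //] h.
- by rewrite -x0; congr (v 0 _); exact/val_inj.
- by rewrite -[RHS]oppr0 -x0 -yE; congr (v 0 _); exact/val_inj.
- by rewrite -z0; congr (v 0 _); exact/val_inj.
- by rewrite -w0; congr (v 0 _); exact/val_inj.
Qed.

End Sokolov.

Theorem mainTheorem2 (R : realType) (c rho : R) :
  let U := [set p : e3 R | C2 p != 0] in
  let P := @lie_poisson R in
  let P' := sokolov_P' c rho in
  let H := sokolov_H c rho in
  [/\ poisson_on [set: e3 R] P,
      poisson_on U P',
      compatible_on U P P' &
      exists K : mpoly.mpoly (3 + 3) R,
        [/\ functionally_independent
              [tuple H; polyfun K; @C1 R; @C2 R],
            (forall p, bracket P H (polyfun K) p = 0) &
            (forall p, U p -> bracket P' H (polyfun K) p = 0)]].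
Proof.
move=> U P P' H.
have vL a b := (lie_poisson_table_ok R a b).1.
have dL a b p := (lie_poisson_table_ok R a b).2 p.
have vS a b := (sokolov_table_ok c rho a b).1.
have dS a b p := (sokolov_table_ok c rho a b).2 p.
split.
- split; first exact: (antisym_bivector openT (@lie_poissonE R)).
  move=> p _ i j k.
  by rewrite (schouten_antisym (E := lie_poisson_table R) (F := lie_poisson_table R)) ?lie_poisson_jacobi //;
    exact: lie_poissonE.
- split; first exact: (antisym_bivector (@open_C2 R) (sokolov_P'E c rho)).
  move=> p Up i j k.
  rewrite (schouten_antisym (E := sokolov_table c rho) (F := sokolov_table c rho))
    ?sokolov_jacobi //; try exact: sokolov_P'E; by move=> a b; exact: dS.
- move=> p Up i j k.
  rewrite (schouten_antisym (E := lie_poisson_table R) (F := sokolov_table c rho))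
    ?lie_poisson_sokolov_compatible //; try exact: sokolov_P'E; try exact: lie_poissonE.
  by move=> a b; exact: dS.
exists (mpoly_of 5 (K_exp c rho)); rewrite (@polyfun_mpoly_of R 5) //.
split; first exact: sokolov_independent.
  by move=> p; exact: lie_poisson_involution.
(* Summing over the first index first isolates the components of P' dH, which vanish whatever the
   derivatives of K are. *)
move=> p Up; rewrite /bracket exchange_big big1 // => j _.
by rewrite -mulr_suml sokolov_casimir ?mul0r.
Qed.
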